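(* Let $n\in\{2,3,\ldots\}$, let $\mathsf{L}\colon \mathsf{K}^2\times[0,1]^2\to\mathsf{K}$, and assume that $\prec$ is compatible with $\oplus$. The $\mathcal{C}_{\preceq}$-operator is an $n$-ary $\mathsf{K}$-valued aggregation function w.r.t. $\preceq$ if and only if the following conditions hold (all $b$'s ranging in $[0,1]$): (a) the $\mathcal{C}_{\preceq}$-operator is well defined; for any $\mathbf{u}\in\mathsf{K}$ and $b$, the function $[\mathbf{u},\mathbf{1}]_{\mathsf{K}}\ni\mathbf{x}\mapsto \mathsf{L}(\mathbf{x},\mathbf{u},b,0)$ is non-decreasing w.r.t. $\preceq$; and moreover: - if $n=2$: for any $\mathbf{v}\in\mathsf{K}$ and $b$, $[\mathbf{0},\mathbf{v}]_{\mathsf{K}}\ni\mathbf{x}\mapsto \mathsf{L}(\mathbf{x},\mathbf{0},1,b)\oplus \mathsf{L}(\mathbf{v},\mathbf{x},b,0)$ is non-decreasing w.r.t. $\preceq$; - if $n=3$: for any $\mathbf{v}\in\mathsf{K}$ and $b_2\le b_1$, $[\mathbf{0},\mathbf{v}]_{\mathsf{K}}\ni\mathbf{x}\mapsto \mathsf{L}(\mathbf{x},\mathbf{0},1,b_1)\oplus \mathsf{L}(\mathbf{v},\mathbf{x},b_1,b_2)$ is non-decreasing w.r.t. $\preceq$, and for any $\mathbf{u},\mathbf{v}\in\mathsf{K}$ with $\mathbf{u}\preceq\mathbf{v}$ and $b_2\le b_1$, $[\mathbf{u},\mathbf{v}]_{\mathsf{K}}\ni\mathbf{x}\mapsto \mathsf{L}(\mathbf{x},\mathbf{u},b_1,b_2)\oplus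 \mathsf{L}(\mathbf{v},\mathbf{x},b_2,0)$ is non-decreasing w.r.t. $\preceq$; - if $n\ge4$: for any $\mathbf{u},\mathbf{v}\in\mathsf{K}$ with $\mathbf{u}\preceq\mathbf{v}$ and $b_3\le b_2\le b_1$, $[\mathbf{u},\mathbf{v}]_{\mathsf{K}}\ni\mathbf{x}\mapsto \mathsf{L}(\mathbf{x},\mathbf{u},b_1,b_2)\oplus \mathsf{L}(\mathbf{v},\mathbf{x},b_2,b_3)$ is non-decreasing w.r.t. $\preceq$; (b) $\bigoplus_{i=1}^n \mathsf{L}(\mathbf{0},\mathbf{0},b_i,b_{i+1})=\mathbf{0}$ for any $0=b_{n+1}\le b_n\le\ldots\le b_2\le b_1=1$; (c) $\mathsf{L}(\mathbf{1},\mathbf{0},b_1,b_2)\oplus\bigoplus_{i=2}^n \mathsf{L}(\mathbf{1},\mathbf{1},b_i,b_{i+1})=\mathbf{1}$ for any $0=b_{n+1}\le b_n\le\ldots\le b_2\le b_1=1$.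
   Context: Setting: $\mathsf{U}$ is a non-empty set with a partial order $\preceq_{\mathrm{p}}$ and a commutative associative binary operation $\oplus\colon\mathsf{U}\times\mathsf{U}\to\mathsf{U}$ (called addition). A total order $\preceq$ on $\mathsf{U}$ is an admissible order w.r.t. $\preceq_{\mathrm{p}}$ if $\mathbf{x}\preceq_{\mathrm{p}}\mathbf{z}$ implies $\mathbf{x}\preceq\mathbf{z}$; $\preceq$ is such an order, and $\mathbf{x}\prec\mathbf{z}$ means $\mathbf{x}\preceq\mathbf{z}$ and $\mathbf{x}\ne\mathbf{z}$. $\mathsf{K}\subseteq\mathsf{U}$ is a non-empty set having a least element $\mathbf{0}$ and a greatest element $\mathbf{1}$ w.r.t. $\preceq_{\mathrm{p}}$ (both in $\mathsf{K}$), with $\mathbf{0}\preceq_{\mathrm{p}}\mathbf{1}$ and $\mathbf{0}\ne\mathbf{1}$. $\prec$ is compatible with $\oplus$ if $\mathbf{x}_1\prec\mathbf{x}_2$ implies $\mathbf{x}_1\oplus\mathbf{v}\prec\mathbf{x}_2\oplus\mathbf{v}$ for all $\mathbf{x}_1,\mathbf{x}_2,\mathbf{v}\in\mathsf{U}$. $[n]=\{1,\dots,n\}$. $\mathbf{M}$ is the set of capacities on $[n]$: $\mu\colon 2^{[n]}\to[0,1]$ with $\mu(C)\le\mu(D)$ for $C\subset D$, $\mu(\varnothing)=0$, $\mu([n])=1$. For $\mathbf{X},\mathbf{Z}\in\mathsf{U}^n$, $\mathbf{X}\preceq_{(n)}\mathbf{Z}$ means $\mathbf{x}_i\preceq\mathbf{z}_i$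 for all $i\in[n]$. For $\mathbf{X}=(\mathbf{x}_1,\dots,\mathbf{x}_n)\in\mathsf{K}^n$, $\Pi_{\mathbf{X}}$ is the set of permutations $\sigma$ of $[n]$ with $\mathbf{x}_{\sigma(1)}\preceq\dots\preceq\mathbf{x}_{\sigma(n)}$. The $\mathcal{C}_{\preceq}$-operator is $\mathcal{C}_{\preceq,\sigma,\mathsf{L}}(\mathbf{X},\mu)=\bigoplus_{i=1}^n \mathsf{L}(\mathbf{x}_{\sigma(i)},\mathbf{x}_{\sigma(i-1)},\mu(B_{\sigma(i)}),\mu(B_{\sigma(i+1)}))$ for $\sigma\in\Pi_{\mathbf{X}}$, with $\mathbf{x}_{\sigma(0)}=\mathbf{0}$, $B_{\sigma(i)}=\{\sigma(i),\dots,\sigma(n)\}$ for $i\in[n]$, $B_{\sigma(n+1)}=\varnothing$. It is well defined if, for every $\mathbf{X}\in\mathsf{K}^n$ and $\mu\in\mathbf{M}$, the value is the same for all $\sigma\in\Pi_{\mathbf{X}}$. For $\mathbf{u},\mathbf{v}\in\mathsf{U}$, $[\mathbf{u},\mathbf{v}]_{\mathsf{K}}=\{\mathbf{x}\in\mathsf{K}:\mathbf{u}\preceq\mathbf{x}\preceq\mathbf{v}\}$. A function $\mathsf{H}\colon\mathsf{K}_0\to\mathsf{U}$ with $\mathsf{K}_0\subseteq\mathsf{K}$ is non-decreasing w.r.t. $\preceq$ if $\mathbf{x}_1\preceq\mathbf{x}_2$ implies $\mathsf{H}(\mathbf{x}_1)\preceq\mathsf{H}(\mathbf{x}_2)$.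 The operator is called an $n$-ary $\mathsf{K}$-valued aggregation function w.r.t. $\preceq$ if it satisfies (M): $\mathbf{X},\mathbf{Z}\in\mathsf{K}^n$, $\mathbf{X}\preceq_{(n)}\mathbf{Z}$ imply $\mathcal{C}_{\preceq,\sigma,\mathsf{L}}(\mathbf{X},\mu)\preceq\mathcal{C}_{\preceq,\tau,\mathsf{L}}(\mathbf{Z},\mu)$ for all $\sigma\in\Pi_{\mathbf{X}}$, $\tau\in\Pi_{\mathbf{Z}}$, $\mu\in\mathbf{M}$; and the boundary conditions: for all $\mu\in\mathbf{M}$ and all admissible $\sigma$, its value at $(\mathbf{0},\dots,\mathbf{0})$ is $\mathbf{0}$ and at $(\mathbf{1},\dots,\mathbf{1})$ is $\mathbf{1}$. *)

(* Defs.v *)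
From HB Require Import structures.
From mathcomp Require Import all_boot all_order all_algebra all_fingroup.
From mathcomp Require Import boolp classical_sets reals.

Set Implicit Arguments.
Unset Strict Implicit.
Unset Printing Implicit Defensive.

Import Order.TTheory GRing.Theory Num.Theory.

Local Open Scope ring_scope.

Definition partial_order (T : Type) (r : rel T) : Prop :=
  [/\ reflexive r, antisymmetric r & transitive r].

(* The total order of [U] is the one of its [orderType] structure, so the
   partial order that it refines is a separate relation [lep]. *)
Definition admissible_order (d : Order.disp_t) (U : orderType d)
    (lep : rel U) : Prop :=
  forall x z : U, lep x z -> (x <= z)%O.

Definition least_in (T : Type) (r : rel T) (K : set T) (m : T) : Prop :=
  K m /\ forall x, K x -> r m x.

Definition greatest_in (T : Type) (r : rel T) (K : set T) (m : T) : Prop :=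
  K m /\ forall x, K x -> r x m.

Definition lt_compatible (d : Order.disp_t) (U : orderType d)
    (add : U -> U -> U) : Prop :=
  forall x1 x2 v : U, (x1 < x2)%O -> (add x1 v < add x2 v)%O.

(* [add] has no neutral element: the sum of [F m], ..., [F n], for [m <= n],
   is [F m + (... + (F n.-1 + F n))], i.e. the iteration starts from [F n]. *)
Definition bigadd (T : Type) (add : T -> T -> T) (m n : nat)
    (F : nat -> T) : T :=
  \big[add/F n]_(m <= i < n) F i.

Definition segment (d : Order.disp_t) (U : orderType d) (K : set U)
    (u v : U) : set U :=
  [set x | K x /\ (u <= x <= v)%O].

Definition nondecreasing_on (d : Order.disp_t) (U : orderType d)
    (D : set U) (H : U -> U) : Prop :=
  {in D &, {homo H : x y / (x <= y)%O}}.

Definition capacity (R : realType) (n : nat) (mu : {set 'I_n} -> R) : Prop :=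
  [/\ forall C, 0 <= mu C <= 1,
      {homo mu : C D / C \subset D >-> C <= D},
      mu finset.set0 = 0 & mu [set: 'I_n]%SET = 1].

(* The permutations that arrange [X] in non-decreasing order. *)
Definition sorting (d : Order.disp_t) (U : orderType d) (n : nat)
    (X : 'I_n -> U) (s : 'S_n) : Prop :=
  sorted <=%O [seq X (s i) | i <- enum 'I_n].

(* Positions are counted from 1 as on paper, so that position [k] with
   [1 <= k <= n] is the ordinal of value [k.-1]; position 0 carries [bot]. *)
Definition xsig (U : Type) (bot : U) (n : nat) (X : 'I_n -> U) (s : 'S_n)
    (k : nat) : U :=
  nth bot (bot :: [seq X (s i) | i <- enum 'I_n]) k.

Definition Bsig (n : nat) (s : 'S_n) (k : nat) : {set 'I_n} :=
  [set s j | j : 'I_n & (k <= j.+1)%N]%SET.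

Definition Cop (R : realType) (U : Type) (add : U -> U -> U) (bot : U)
    (L : U -> U -> R -> R -> U) (n : nat) (s : 'S_n)
    (X : 'I_n -> U) (mu : {set 'I_n} -> R) : U :=
  bigadd add 1 n (fun i =>
    L (xsig bot X s i) (xsig bot X s i.-1)
      (mu (Bsig s i)) (mu (Bsig s i.+1))).

Definition well_defined (R : realType) (d : Order.disp_t) (U : orderType d)
    (add : U -> U -> U) (K : set U) (bot : U)
    (L : U -> U -> R -> R -> U) (n : nat) : Prop :=
  forall (X : 'I_n -> U) (mu : {set 'I_n} -> R),
    (forall i, K (X i)) -> capacity mu ->
  forall s t : 'S_n, sorting X s -> sorting X t ->
    Cop add bot L s X mu = Cop add bot L t X mu.

Definition monotone (R : realType) (d : Order.disp_t) (U : orderType d)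
    (add : U -> U -> U) (K : set U) (bot : U)
    (L : U -> U -> R -> R -> U) (n : nat) : Prop :=
  forall X Z : 'I_n -> U,
    (forall i, K (X i)) -> (forall i, K (Z i)) ->
    (forall i, (X i <= Z i)%O) ->
  forall (s t : 'S_n) (mu : {set 'I_n} -> R),
    sorting X s -> sorting Z t -> capacity mu ->
    (Cop add bot L s X mu <= Cop add bot L t Z mu)%O.

Definition aggregation_function (R : realType) (d : Order.disp_t)
    (U : orderType d) (add : U -> U -> U) (K : set U) (bot top : U)
    (L : U -> U -> R -> R -> U) (n : nat) : Prop :=
  [/\ monotone add K bot L n,
      forall (mu : {set 'I_n} -> R) (s : 'S_n),
        capacity mu -> sorting (fun=> bot) s ->
        Cop add bot L s (fun=> bot) mu = bot
    & forall (mu : {set 'I_n} -> R) (s : 'S_n),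
        capacity mu -> sorting (fun=> top) s ->
        Cop add bot L s (fun=> top) mu = top].

(* The sequences [0 = b_(n+1) <= b_n <= ... <= b_2 <= b_1 = 1]; the values of
   [b] outside of [1, ..., n+1] are irrelevant. *)
Definition unit_chain (R : realType) (n : nat) (b : nat -> R) : Prop :=
  [/\ b 1%N = 1, b n.+1 = 0
    & forall i, (1 <= i <= n)%N -> b i.+1 <= b i].

(* Main.v *)
(* By compatibility of the strict order with the addition, a common summand can
   be cancelled in an inequality.  Changing the single entry of rank [k] of a
   sorted vector, without changing the order, affects only the summands of ranks
   [k] and [k.+1] of the operator (only the last one if [k = n]), so that the
   monotonicity conditions in (a) say that the operator is monotone along such
   moves.  Given well-definedness, any [X <= Z] can be joined by finitely many
   of them. *)
Require Import Defs.
From HB Require Import structures.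
From mathcomp Require Import all_boot all_order all_algebra all_fingroup.
From mathcomp Require Import boolp classical_sets reals.
From mathcomp Require Import zify.

Set Implicit Arguments.
Unset Strict Implicit.
Unset Printing Implicit Defensive.

Import Order.TTheory GRing.Theory Num.Theory.

Local Open Scope ring_scope.

(** * Sums over an interval of ranks, without neutral element *)

Section BigAdd.
Variables (T : Type) (add : T -> T -> T).
Implicit Types (m n : nat) (F G : nat -> T).

Lemma bigadd_nn n F : bigadd add n n F = F n.
Proof. by rewrite /bigadd big_geq. Qed.

Lemma bigaddS m n F : (m < n)%N ->
  bigadd add m n F = add (F m) (bigadd add m.+1 n F).
Proof. by move=> mn; rewrite /bigadd big_ltn. Qed.

Lemma eq_bigadd m n F G : (m <= n)%N ->
  (forall i, (m <= i <= n)%N -> F i = G i) ->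
  bigadd add m n F = bigadd add m n G.
Proof.
move=> mn FG; rewrite /bigadd FG ?mn ?leqnn//.
by apply: eq_big_nat => i /andP[mi /ltnW ni]; rewrite FG// mi ni.
Qed.

End BigAdd.

(** * Cancellation of common summands *)

Section Cancellation.
Variables (d : Order.disp_t) (U : orderType d) (add : SemiGroup.com_law U).
Hypothesis add_lt : lt_compatible add.

(** The order is total, so strict compatibility also yields the converse: if [a <= b] fails then
    [b < a], and the addition preserves this. *)
Lemma le_add2r a b v : (add a v <= add b v)%O = (a <= b)%O.
Proof.
case: (ltgtP a b) => [ab|ba|->]; last by rewrite lexx.
  by rewrite ltW// add_lt.
by rewrite leNgt add_lt.
Qed.

Lemma le_add2l v a b : (add v a <= add v b)%O = (a <= b)%O.
Proof. by rewrite ![add v _]SemiGroup.Theory.mulmC le_add2r. Qed.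

(** Induction on [k - m]: the summands before rank [k] cancel one by one on the left, the tail after
    [k] cancels at once on the right. *)
Lemma le_bigadd1 m n k (F G : nat -> U) : (m <= k <= n)%N ->
  (forall i, (m <= i <= n)%N -> i != k -> F i = G i) ->
  (bigadd add m n F <= bigadd add m n G)%O = (F k <= G k)%O.
Proof.
move=> /andP[+ kn]; move: {2}(k - m)%N (erefl (k - m)%N) => p.
elim: p m => [|p IH] m km mk FG.
  have ? : m = k by lia.
  subst m.
  have [->|nk] := eqVneq n k; first by rewrite !bigadd_nn.
  rewrite !(@bigaddS _ _ k); try lia.
  rewrite (@eq_bigadd _ _ _ _ F G) ?le_add2r//; first by lia.
  by move=> i i_in; apply: FG; lia.
rewrite !(@bigaddS _ _ m); try lia.
rewrite FG ?le_add2l; try lia.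
by apply: IH => [||i i_in]; [lia|lia|apply: FG; lia].
Qed.

Lemma le_bigadd2 m n k (F G : nat -> U) : (m <= k < n)%N ->
  (forall i, (m <= i <= n)%N -> i != k -> i != k.+1 -> F i = G i) ->
  (bigadd add m n F <= bigadd add m n G)%O =
  (add (F k) (F k.+1) <= add (G k) (G k.+1))%O.
Proof.
move=> /andP[+ kn]; move: {2}(k - m)%N (erefl (k - m)%N) => p.
elim: p m => [|p IH] m km mk FG.
  have ? : m = k by lia.
  subst m.
  rewrite !(@bigaddS _ _ k n)//.
  have [->|nk] := eqVneq n k.+1; first by rewrite !bigadd_nn.
  rewrite !(@bigaddS _ _ k.+1); try lia.
  (* Associativity groups the two changed summands, so that the common tail can be cancelled. *)
  rewrite !SemiGroup.opA (@eq_bigadd _ _ _ _ F G) ?le_add2r//; first by lia.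
  by move=> i i_in; apply: FG; lia.
rewrite !(@bigaddS _ _ m); try lia.
rewrite FG ?le_add2l; try lia.
by apply: IH => [||i i_in]; [lia|lia|apply: FG; lia].
Qed.

End Cancellation.

(** * Sorting permutations *)

Section Sorting.
Variables (d : Order.disp_t) (U : orderType d) (n : nat).
Implicit Types (X Z : 'I_n -> U) (s : 'S_n).

Lemma xsigS (V : Type) (bot : V) (X : 'I_n -> V) s (i : 'I_n) :
  xsig bot X s i.+1 = X (s i).
Proof.
by rewrite /xsig /= (nth_map i) ?size_enum_ord ?ltn_ord// nth_ord_enum.
Qed.

(** Since [bot] lies below every entry, prepending it keeps the list sorted, and position 0 is
    covered too. *)
Lemma sorting_xsig bot X s : (forall i, bot <= X i)%O -> sorting X s ->
  {in [pred k | (k <= n)%N] &,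
    {homo xsig bot X s : i j / (i <= j)%N >-> (i <= j)%O}}.
Proof.
move=> botX sX i j; rewrite !inE => i_n j_n; apply: (sorted_leq_nth le_trans).
- by [].
- rewrite /= path_sortedE; last exact: le_trans.
  by apply/andP; split=> //; apply/allP => _ /mapP[k _ ->].
- by rewrite inE /= size_map size_enum_ord.
- by rewrite inE /= size_map size_enum_ord.
Qed.

Lemma sorting_cst (x : U) s : sorting (fun=> x) s.
Proof.
by rewrite /sorting; elim: (enum _) => //= i [|j t] //= ->; rewrite lexx.
Qed.

(* Sort by [X] and break the ties by [Z]. *)
Lemma comonotone_sorting X Z :
  (forall i j, (X i < X j)%O -> (Z i <= Z j)%O) ->
  exists s, sorting X s /\ sorting Z s.
Proof.
move=> XZ.
pose r i j := ((X i < X j) || (X i == X j) && (Z i <= Z j))%O.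
have r_total : total r.
  by move=> i j; rewrite /r; case: ltgtP => //= _; exact: le_total.
have /tuple_permP[s sE] : perm_eq (sort r (enum 'I_n)) (ord_tuple n).
  by rewrite perm_sort val_ord_tuple.
have {}sE : [seq s i | i <- enum 'I_n] = sort r (enum 'I_n).
  by rewrite sE /=; apply: eq_map => i; rewrite tnth_ord_tuple.
have r_sorted : sorted r [seq s i | i <- enum 'I_n].
  by rewrite sE; exact: sort_sorted.
exists s; split; rewrite /sorting (map_comp _ s) sorted_map.
  apply: sub_sorted r_sorted => i j /=.
  by case/orP => [/ltW//|/andP[/eqP-> _]].
apply: sub_sorted r_sorted => i j /=.
by case/orP => [/XZ//|/andP[]].
Qed.

End Sorting.

(** * Capacities and chains of weights *)

Section Capacities.
Variables (R : realType) (n : nat).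
Implicit Types (b : nat -> R) (mu : {set 'I_n} -> R).

Lemma unit_chain_anti b : unit_chain n b ->
  forall i j, (0 < i)%N -> (i <= j <= n.+1)%N -> b j <= b i.
Proof.
move=> [_ _ bS] i j i0; elim: j => [|j IH] ij; first by lia.
have [->//|ij'] := eqVneq i j.+1.
by apply: (le_trans (bS j _)); [lia|apply: IH; lia].
Qed.

Lemma unit_chain_itv b : unit_chain n b ->
  forall i, (0 < i <= n.+1)%N -> 0 <= b i <= 1.
Proof.
move=> bc i /andP[i0 i_n]; have [b1 bn _] := bc.
by rewrite -{1}bn -b1 !(unit_chain_anti bc)//; lia.
Qed.

Lemma card_Bsig (s : 'S_n) k : (0 < k)%N -> (#|Bsig s k| = n.+1 - k)%N.
Proof.
move=> k0; rewrite /Bsig card_imset; last exact: perm_inj.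
have -> : (n.+1 - k = \sum_(k.-1 <= j < n) 1)%N.
  by rewrite sum_nat_const_nat; lia.
rewrite big_geq_mkord -sum1_card; apply: eq_bigl => j.
by rewrite inE /= -[in LHS](prednK k0).
Qed.

Lemma capacity_chain mu (s : 'S_n) : capacity mu ->
  unit_chain n (fun k => mu (Bsig s k)).
Proof.
move=> [mu01 mu_mono mu0 mu1]; split.
- rewrite -mu1; congr mu; apply/setP => i; rewrite inE.
  by apply/imsetP; exists ((s^-1)%g i); rewrite ?inE ?permKV.
- rewrite -mu0; congr mu; apply/setP => i; rewrite inE.
  apply/imsetP => -[j]; rewrite inE => /leq_trans-/(_ _ (ltn_ord j)).
  by rewrite ltnn.
- move=> i _; apply/mu_mono/imsetS/fintype.subsetP => j; rewrite !inE.
  exact: ltnW.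
Qed.

(** Every chain comes from a capacity that depends on cardinality only: [Bsig s k] has [n.+1 - k]
    elements, so the capacity takes the value [b k] there, whatever the permutation [s]. *)
Lemma chain_capacity b : unit_chain n b ->
  capacity (fun C : {set 'I_n} => b (n.+1 - #|C|)%N).
Proof.
move=> bc; have [b1 bn _] := bc.
have cardn (C : {set 'I_n}) : (#|C| <= n)%N.
  by rewrite -[X in (_ <= X)%N]card_ord max_card.
split=> [C|C D CD||].
- by apply: (unit_chain_itv bc); have := cardn C; lia.
- have := cardn D; have := subset_leq_card CD.
  by move=> *; apply: (unit_chain_anti bc); lia.
- by rewrite cards0 subn0.
- by rewrite cardsT card_ord subSnn.
Qed.

End Capacities.

(** * The operator as a sum along sorted values *)

Section Operator.
Variables (R : realType) (d : Order.disp_t) (U : orderType d).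
Variables (add : SemiGroup.com_law U) (K : set U) (bot top : U).
Variables (L : U -> U -> R -> R -> U) (n : nat).
Hypothesis add_lt : lt_compatible add.
Hypotheses (Kbot : K bot) (Ktop : K top).
Hypotheses (le_bot : forall x, K x -> (bot <= x)%O).
Hypotheses (le_top : forall x, K x -> (x <= top)%O).
Implicit Types (X Z : 'I_n -> U) (s t : 'S_n) (mu : {set 'I_n} -> R).
Implicit Types (y z : nat -> U) (b : nat -> R).

(** The operator detached from permutation and capacity: [y] stands for the sorted entries, [b] for
    the weights of the nested sets. *)
Definition chain_sum y b : U :=
  bigadd add 1 n (fun i => L (y i) (y i.-1) (b i) (b i.+1)).

Lemma eq_chain_sum y z a b : (0 < n)%N ->
  (forall i, (i <= n)%N -> y i = z i) ->
  (forall i, (0 < i <= n.+1)%N -> a i = b i) ->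
  chain_sum y a = chain_sum z b.
Proof.
by move=> n0 yz ab; apply: eq_bigadd => // i i_n; rewrite !yz ?ab//; lia.
Qed.

Lemma le_chain_sum_last y z b : (0 < n)%N ->
  (forall i, (i < n)%N -> y i = z i) ->
  (chain_sum y b <= chain_sum z b)%O =
  (L (y n) (y n.-1) (b n) (b n.+1) <= L (z n) (z n.-1) (b n) (b n.+1))%O.
Proof.
move=> n0 yz; rewrite /chain_sum (le_bigadd1 add_lt (k := n)) ?n0 ?leqnn//.
by move=> i i_n ni; rewrite !yz//; lia.
Qed.

Lemma le_chain_sum_mid y z b k : (0 < k < n)%N ->
  (forall i, (i <= n)%N -> i != k -> y i = z i) ->
  (chain_sum y b <= chain_sum z b)%O =
  (add (L (y k) (y k.-1) (b k) (b k.+1))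
       (L (y k.+1) (y k) (b k.+1) (b k.+2))
   <= add (L (z k) (z k.-1) (b k) (b k.+1))
          (L (z k.+1) (z k) (b k.+1) (b k.+2)))%O.
Proof.
move=> kn yz; rewrite /chain_sum (le_bigadd2 add_lt (k := k))//.
by move=> i i_n ki kSi; rewrite !yz//; lia.
Qed.

(** Concerns moves of the entry of rank [n]: no entry follows it, so only [top] bounds it above, and
    the second weight is that of the empty set. *)
Definition last_step : Prop := forall (u : U) (b : R), K u -> 0 <= b <= 1 ->
  nondecreasing_on (segment K u top) (fun x => L x u b 0).

(* The increment at [k = 1] starts from [x_(sigma(0))], which is [bot]. *)
Definition mid_step k : Prop := forall (u v : U) b, K u -> K v -> (u <= v)%O ->
  (k = 1%N -> u = bot) -> unit_chain n b ->
  nondecreasing_on (segment K u v)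
    (fun x => add (L x u (b k) (b k.+1)) (L v x (b k.+1) (b k.+2))).

Lemma in_segment u v x :
  (x \in segment K u v) <-> K x /\ (u <= x)%O /\ (x <= v)%O.
Proof.
rewrite inE /segment /=; split=> [[Kx /andP[]]//|[Kx [ux xv]]].
by split=> //; rewrite ux.
Qed.

(** Makes chain sums accessible to hypotheses on the operator: the identity leaves the entries in
    place and the capacity by cardinality returns the weights [b]. *)
Lemma Cop_chain y b : (0 < n)%N -> y 0%N = bot ->
  Cop add bot L 1%g (fun i => y i.+1) (fun C : {set 'I_n} => b (n.+1 - #|C|)%N)
  = chain_sum y b.
Proof.
move=> n0 y0; apply: eq_chain_sum => // [[|i] i_n|i /andP[i0 i_n]].
- by rewrite y0.
- by rewrite (xsigS _ _ _ (Ordinal i_n)) perm1.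
- by rewrite card_Bsig// subKn.
Qed.

Lemma sorting1 y : {homo y : i j / (i <= j)%N >-> (i <= j)%O} ->
  sorting (fun i : 'I_n => y i.+1) 1%g.
Proof.
move=> y_homo; rewrite /sorting sorted_map.
have : sorted (relpre val leq) (enum 'I_n).
  by rewrite -sorted_map val_enum_ord iota_sorted.
by apply: sub_sorted => i j ij /=; rewrite !perm1 y_homo.
Qed.

(** * From monotonicity to the conditions on single moves *)

Section Necessity.
Hypothesis mono : monotone add K bot L n.

(** Comparing [X] with itself, with the two permutations in either order, gives both
    inequalities. *)
Lemma monotone_well_defined : well_defined add K bot L n.
Proof.
move=> X mu KX cmu s t sX tX.
by apply/eqP; rewrite eq_le !(mono KX KX).
Qed.

Lemma monotone_chain_sum y z b : (0 < n)%N -> y 0%N = bot -> z 0%N = bot ->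
  (forall i, K (y i)) -> (forall i, K (z i)) ->
  {homo y : i j / (i <= j)%N >-> (i <= j)%O} ->
  {homo z : i j / (i <= j)%N >-> (i <= j)%O} ->
  (forall i, (y i <= z i)%O) -> unit_chain n b ->
  (chain_sum y b <= chain_sum z b)%O.
Proof.
move=> n0 y0 z0 Ky Kz y_homo z_homo yz bc; rewrite -!Cop_chain//.
by apply: mono => // *; [exact: sorting1|exact: sorting1|exact: chain_capacity].
Qed.

(** Test vector for moving one entry: with [u] before rank [k] and [v] after it, [x] may range over
    the whole segment while the vector stays sorted. *)
Definition single_step k (u x v : U) i : U :=
  if i == 0%N then bot else if (i < k)%N then u else if i == k then x else v.

Lemma single_step_K k u x v : K u -> K x -> K v ->
  forall i, K (single_step k u x v i).
Proof. by move=> Ku Kx Kv i; rewrite /single_step; do 3?case: ifP. Qed.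

Lemma single_step_homo k u x v : K u -> K x -> K v ->
  (u <= x)%O -> (x <= v)%O ->
  {homo single_step k u x v : i j / (i <= j)%N >-> (i <= j)%O}.
Proof.
move=> Ku Kx Kv ux xv i j ij; have uv := le_trans ux xv.
rewrite /single_step; do 6?case: ifP => ?; rewrite ?lexx ?le_bot//; lia.
Qed.

(** For [k = 1] the predecessor is position 0, which carries [bot]; hence the condition on [u]. *)
Lemma single_step_pred k u x v : (0 < k)%N -> (k = 1%N -> u = bot) ->
  single_step k u x v k.-1 = u.
Proof.
rewrite /single_step => k0 ku; case: eqP => [k1|_].
  by rewrite ku//; lia.
by rewrite ifT//; lia.
Qed.

Lemma single_step_self k u x v : (0 < k)%N -> single_step k u x v k = x.
Proof. by case: k => // k _; rewrite /single_step ltnn eqxx. Qed.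

Lemma single_step_succ k u x v : single_step k u x v k.+1 = v.
Proof. by rewrite /single_step ltnNge leqnSn /= gtn_eqF. Qed.

Lemma monotone_single_step k u v x x' b : (0 < n)%N ->
  K u -> K v -> x \in segment K u v -> x' \in segment K u v -> (x <= x')%O ->
  unit_chain n b ->
  (chain_sum (single_step k u x v) b <= chain_sum (single_step k u x' v) b)%O.
Proof.
move=> n0 Ku Kv /in_segment[Kx [ux xv]] /in_segment[Kx' [ux' x'v]] xx' bc.
apply: monotone_chain_sum => //.
- exact: single_step_K.
- exact: single_step_K.
- exact: single_step_homo.
- exact: single_step_homo.
- by move=> i; rewrite /single_step; do 3?case: ifP.
Qed.

Lemma monotone_last_step : (1 < n)%N -> last_step.
Proof.
move=> n1 u b Ku /andP[b0 b1] x x' xu xu' xx'.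
(* A chain whose values at ranks [n] and [n.+1] are [b] and 0; rank 1 is forced to carry 1, so
   [1 < n] leaves rank [n] free. *)
pose c i : R := if (i <= 1)%N then 1 else if (i <= n)%N then b else 0.
have cc : unit_chain n c.
  split=> [//||i i_n]; rewrite /c; first by rewrite ltnn ifF//; lia.
  by do 4?case: ifP => //; lia.
have n0 : (0 < n)%N by lia.
have := monotone_single_step n n0 Ku Ktop xu xu' xx' cc.
rewrite le_chain_sum_last//; last first.
  by move=> i i_n; rewrite /single_step i_n.
have -> : c n = b by rewrite /c leqnn leqNgt n1.
have -> : c n.+1 = 0 by rewrite /c ltnn leqNgt ltnS n0.
by rewrite !single_step_pred ?single_step_self//; lia.
Qed.

Lemma monotone_mid_step k : (0 < k < n)%N -> mid_step k.
Proof.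
move=> kn u v b Ku Kv uv ku bc x x' xu xu' xx'.
have n0 : (0 < n)%N by lia.
have := monotone_single_step k n0 Ku Kv xu xu' xx' bc.
rewrite (le_chain_sum_mid _ kn); last first.
  by move=> i i_n /negPf ki; rewrite /single_step ki.
by rewrite !single_step_pred ?single_step_self ?single_step_succ//; lia.
Qed.

End Necessity.

(** * From single moves to monotonicity *)

Section Sufficiency.
Hypothesis wd : well_defined add K bot L n.
Hypothesis lastP : last_step.
Hypothesis midP : forall k, (0 < k < n)%N -> mid_step k.

(** A permutation sorting both vectors gives both sides the same weights; [lastP] or [midP] then
    applies, according to whether the rank [p.+1] is [n]. *)
Lemma le_Cop_comonotone X Z s mu (p : 'I_n) :
  (forall i, K (X i)) -> (forall i, K (Z i)) ->
  sorting X s -> sorting Z s -> capacity mu ->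
  (X (s p) <= Z (s p))%O -> (forall i, i != p -> X (s i) = Z (s i)) ->
  (Cop add bot L s X mu <= Cop add bot L s Z mu)%O.
Proof.
move=> KX KZ sX sZ cmu XZp XZ.
pose y := xsig bot X s; pose z := xsig bot Z s; pose b k := mu (Bsig s k).
have bc : unit_chain n b by exact: capacity_chain.
rewrite -[leLHS]/(chain_sum y b) -[leRHS]/(chain_sum z b).
have Ky i : (i <= n)%N -> K (y i).
  by case: i => [//|i] i_n; rewrite /y (xsigS _ _ _ (Ordinal i_n)).
have Kz i : (i <= n)%N -> K (z i).
  by case: i => [//|i] i_n; rewrite /z (xsigS _ _ _ (Ordinal i_n)).
have yz i : (i <= n)%N -> i != p.+1 -> y i = z i.
  by case: i => [//|i] i_n ip; rewrite /y /z !(xsigS _ _ _ (Ordinal i_n)) XZ.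
have y_homo := sorting_xsig (fun i => le_bot (KX i)) sX.
have z_homo := sorting_xsig (fun i => le_bot (KZ i)) sZ.
have yzp : (y p.+1 <= z p.+1)%O by rewrite /y /z !xsigS.
have p_n := ltn_ord p.
have yp : (y p <= y p.+1)%O by apply: y_homo; rewrite ?inE; lia.
have zp : (z p <= z p.+1)%O by apply: z_homo; rewrite ?inE; lia.
have yzp1 : y p = z p by apply: yz; lia.
have [np|np] := eqVneq p.+1 n.
  rewrite le_chain_sum_last; [|lia|by move=> i i_n; apply: yz; lia].
  have bp2 : b p.+2 = 0 by rewrite np; case: bc.
  rewrite -np /= -yzp1 bp2.
  apply: lastP => //.
  - by apply: Ky; lia.
  - by apply: (unit_chain_itv bc); lia.
  - by apply/in_segment; split; [exact: Ky|split=> //; exact/le_top/Ky].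
  - apply/in_segment; split; [exact: Kz|split; last exact/le_top/Kz].
    by rewrite yzp1.
have pn : (0 < p.+1 < n)%N by lia.
rewrite (le_chain_sum_mid _ pn) /=; last by move=> i i_n ip; apply: yz.
have yzp2 : y p.+2 = z p.+2 by apply: yz; lia.
have yp2 : (y p.+1 <= y p.+2)%O by apply: y_homo; rewrite ?inE; lia.
have zp2 : (z p.+1 <= z p.+2)%O by apply: z_homo; rewrite ?inE; lia.
rewrite -yzp1 -yzp2; apply: (midP pn) => //.
- by apply: Ky; lia.
- by apply: Ky; lia.
- exact: le_trans yp2.
- by case=> ->.
- by apply/in_segment; split; [exact: Ky|].
- by apply/in_segment; split; [exact: Kz|rewrite yzp1 yzp2].
Qed.

(* Raising [X j] past other entries of [X] changes the sorting permutation; the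
   rise is cut at those entries, where well-definedness allows to switch from
   one permutation to the next. *)
Lemma le_Cop_raise X Z s t mu (j : 'I_n) :
  (forall i, K (X i)) -> (forall i, K (Z i)) ->
  sorting X s -> sorting Z t -> capacity mu ->
  (X j <= Z j)%O -> (forall i, i != j -> X i = Z i) ->
  (Cop add bot L s X mu <= Cop add bot L t Z mu)%O.
Proof.
move=> + + + + cmu.
(* The entries strictly inside the rise; their number is the induction measure. *)
pose between (X Z : 'I_n -> U) : {set 'I_n} := [set i | X j < X i < Z j]%O%SET.
have [m] := ubnP #|between X Z|.
elim: m X Z s t => // m IH X Z s t; rewrite ltnS => le_m KX KZ sX tZ XZj XZ.
have [btw0|[i i_btw]] := set_0Vmem (between X Z).
  (* No entry is strictly overtaken, so one permutation sorts both vectors. *)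
  have XZ_co i k : (X i < X k)%O -> (Z i <= Z k)%O.
    have [->{i}|ij] := eqVneq i j; have [->{k}|kj] := eqVneq k j.
    - by rewrite ltxx.
    - rewrite -(XZ k)// => jk; rewrite leNgt; apply/negP => kZ.
      have : k \in between X Z by rewrite inE jk kZ.
      by rewrite btw0 inE.
    - by rewrite -(XZ i)// => /ltW/le_trans; apply.
    - by rewrite -!XZ// => /ltW.
  have [r [rX rZ]] := comonotone_sorting XZ_co.
  rewrite (wd KX cmu sX rX) (wd KZ cmu tZ rZ).
  apply: (le_Cop_comonotone (p := (r^-1)%g j)) => //; rewrite ?permKV//.
  move=> i /eqP ij; apply: XZ; apply/eqP => rij; apply: ij.
  by rewrite -rij permK.
have /andP[ji iZ] : (X j < X i < Z j)%O by rewrite inE in i_btw.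
(* The rise pauses at the value [X i]. Each half has fewer entries strictly inside, as [i] now sits
   at an endpoint of both. *)
pose Y k := if k == j then X i else X k.
have Yj : Y j = X i by rewrite /Y eqxx.
have Yk k : k != j -> Y k = X k by rewrite /Y => /negPf ->.
have KY k : K (Y k) by rewrite /Y; case: ifP.
have [|r [rY _]] := @comonotone_sorting _ _ _ Y Y; first by move=> ? ? /ltW.
apply: (@le_trans _ _ (Cop add bot L r Y mu)).
  apply: (IH _ _ _ _ _ KX KY sX rY); last by move=> k /Yk.
    apply: leq_trans le_m; apply: proper_card; apply/properP; split.
      apply/fintype.subsetP => k; rewrite !inE Yj => /andP[-> ki] /=.
      exact: lt_trans iZ.
    by exists i; rewrite // inE Yj ltxx andbF.
  by rewrite Yj ltW.
apply: (IH _ _ _ _ _ KY KZ rY tZ); last by move=> k kj; rewrite Yk ?XZ.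
  apply: leq_trans le_m; apply: proper_card; apply/properP; split.
    apply/fintype.subsetP => k; rewrite !inE Yj.
    have [->|kj] := eqVneq k j; first by rewrite Yj ltxx.
    by rewrite Yk// => /andP[ik ->]; rewrite (lt_trans ji ik).
  exists i; rewrite // inE Yj Yk ?ltxx//.
  by apply/eqP => ij; rewrite ij ltxx in ji.
by rewrite Yj ltW.
Qed.

Lemma local_monotone : monotone add K bot L n.
Proof.
move=> X Z KX KZ XZ s t mu sX tZ cmu.
(* Passing from [W k] to [W k.+1] raises only the entry of index [k], as [le_Cop_raise] requires. *)
pose W k (i : 'I_n) := if (i < k)%N then Z i else X i.
have KW k i : K (W k i) by rewrite /W; case: ifP.
have Wn : W n = Z by apply/funext => i; rewrite /W ltn_ord.
suff le_W k r : (k <= n)%N -> sorting (W k) r ->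
    (Cop add bot L s X mu <= Cop add bot L r (W k) mu)%O.
  by rewrite -Wn; apply: le_W => //; rewrite Wn.
elim: k r => [|k IH] r k_n rW.
  have W0 : W 0%N = X by apply/funext => i; rewrite /W ltn0.
  by move: rW; rewrite W0 => rX; rewrite (wd KX cmu sX rX).
have [|q [qW _]] := @comonotone_sorting _ _ _ (W k) (W k).
  by move=> ? ? /ltW.
apply: (le_trans (IH q (ltnW k_n) qW)).
apply: (le_Cop_raise (j := Ordinal k_n)) => //.
  by rewrite /W /= ltnn ltnS leqnn.
move=> i ik; rewrite /W ltnS [in RHS]leq_eqVlt.
by case: eqP => // ik'; case/eqP: ik; apply/val_inj.
Qed.

End Sufficiency.

(** * Boundary conditions at constant vectors *)

Lemma Cop_cst s mu x : (0 < n)%N ->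
  Cop add bot L s (fun=> x) mu =
  chain_sum (fun i => if i == 0%N then bot else x) (fun k => mu (Bsig s k)).
Proof.
move=> n0; apply: eq_chain_sum => // -[|i] i_n //.
by rewrite (xsigS _ _ _ (Ordinal i_n)).
Qed.

(** Every permutation sorts a constant vector, so only the weights matter, and those given by
    capacities are exactly the unit chains. *)
Lemma boundary_chain_sum x c : (0 < n)%N ->
  (forall mu s, capacity mu -> sorting (fun=> x) s ->
     Cop add bot L s (fun=> x) mu = c) <->
  (forall b, unit_chain n b ->
     chain_sum (fun i => if i == 0%N then bot else x) b = c).
Proof.
move=> n0; split=> H.
  move=> b bc.
  rewrite -(H _ 1%g (chain_capacity bc) (sorting_cst _ _)) Cop_cst//.
  by apply: eq_chain_sum => // i /andP[i0 i_n]; rewrite card_Bsig// subKn.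
by move=> mu s cmu _; rewrite Cop_cst//; apply: H; exact: capacity_chain.
Qed.

Lemma chain_sum_bot b : (0 < n)%N ->
  chain_sum (fun i => if i == 0%N then bot else bot) b =
  bigadd add 1 n (fun i => L bot bot (b i) (b i.+1)).
Proof. by move=> n0; apply: eq_bigadd => // i _; rewrite !if_same. Qed.

(** Only the summand of rank 1 has predecessor [bot]; splitting it off leaves a nonempty sum because
    [1 < n]. *)
Lemma chain_sum_cst x b : (1 < n)%N ->
  chain_sum (fun i => if i == 0%N then bot else x) b =
  add (L x bot (b 1%N) (b 2%N))
      (bigadd add 2 n (fun i => L x x (b i) (b i.+1))).
Proof.
move=> n1; rewrite /chain_sum bigaddS//; congr (add _ _).
by apply: eq_bigadd => // -[|[|i]].
Qed.

(** * The conditions on single moves in each dimension *)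

Lemma monotoneP : (1 < n)%N ->
  monotone add K bot L n <->
  [/\ well_defined add K bot L n, last_step
    & forall k, (0 < k < n)%N -> mid_step k].
Proof.
move=> n1; split=> [mono|[wd lastP midP]]; last exact: local_monotone.
split; first exact: monotone_well_defined.
  exact: monotone_last_step.
by move=> k; exact: monotone_mid_step.
Qed.

(** The values [b 1 = 1] and [b n.+1 = 0] are fixed. The window [b k], [b k.+1], [b k.+2] contains
    both for [n = 2] and exactly one of them for [n = 3]; from [n = 4] on, the window at [k = 2]
    avoids both and its condition implies all others. *)
Lemma mid_step_cases : (1 < n)%N ->
  (forall k, (0 < k < n)%N -> mid_step k) <->
  [/\ n = 2%N ->
      forall (v : U) (b : R), K v -> 0 <= b <= 1 ->
        nondecreasing_on (segment K bot v)
          (fun x => add (L x bot 1 b) (L v x b 0)),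
      n = 3%N ->
      (forall (v : U) (b1 b2 : R), K v ->
         0 <= b2 -> b2 <= b1 -> b1 <= 1 ->
         nondecreasing_on (segment K bot v)
           (fun x => add (L x bot 1 b1) (L v x b1 b2)))
      /\ (forall (u v : U) (b1 b2 : R), K u -> K v -> (u <= v)%O ->
         0 <= b2 -> b2 <= b1 -> b1 <= 1 ->
         nondecreasing_on (segment K u v)
           (fun x => add (L x u b1 b2) (L v x b2 0)))
    & (4 <= n)%N ->
      forall (u v : U) (b1 b2 b3 : R), K u -> K v -> (u <= v)%O ->
        0 <= b3 -> b3 <= b2 -> b2 <= b1 -> b1 <= 1 ->
        nondecreasing_on (segment K u v)
          (fun x => add (L x u b1 b2) (L v x b2 b3))].
Proof.
move=> n1; split=> [mid|[mid2 mid3 mid4]].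
  split=> [n2 v b Kv /andP[b0 b1]|n3|].
  (* The list is read from index 1, index 0 being a filler; the default 0 of [nth] supplies
     [b n.+1]. *)
  - apply: (mid 1%N _ bot v (nth 0 [:: 1; 1; b])) => //; first exact: le_bot.
    by rewrite n2; split=> // -[|[|[|i]]].
  - split=> [v b1 b2 Kv b2_0 b21 b1_1|u v b1 b2 Ku Kv uv b2_0 b21 b1_1].
      apply: (mid 1%N _ bot v (nth 0 [:: 1; 1; b1; b2])) => //.
        exact: le_bot.
      by rewrite n3; split=> // -[|[|[|[|i]]]].
    apply: (mid 2%N _ u v (nth 0 [:: 1; 1; b1; b2])) => //; first by rewrite n3.
    by rewrite n3; split=> // -[|[|[|[|i]]]].
  - move=> n4 u v b1 b2 b3 Ku Kv uv b3_0 b32 b21 b1_1.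
    (* The window at rank 2 is [b1], [b2], [b3]; the weights from index 5 on, hence at [n.+1], are 0
       by default. *)
    apply: (mid 2%N _ u v (nth 0 [:: 1; 1; b1; b2; b3])) => //; first by lia.
    split=> //; first by case: n n4 => [|[|[|[|m]]]] //= _; rewrite nth_nil.
    by move=> [|[|[|[|[|i]]]]] //=; rewrite !nth_nil.
move=> k kn u v b Ku Kv uv ku bc; have [b1 bn _] := bc.
have b01 i : (0 < i <= n.+1)%N -> 0 <= b i <= 1 by exact: unit_chain_itv.
have b_anti i : (0 < i <= n)%N -> b i.+1 <= b i by have [_ _] := bc; apply.
have [n2|n2] := eqVneq n 2.
  have k1 : k = 1%N by lia.
  have -> : b k.+2 = 0 by rewrite -bn; congr b; lia.
  rewrite k1 (ku k1) b1.
  by apply: mid2 => //; apply: b01; lia.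
have [n3|n3] := eqVneq n 3.
  have [mid31 mid32] := mid3 n3.
  have [k1|k1] := eqVneq k 1.
    rewrite k1 (ku k1) b1; apply: mid31 => //.
    - by have /andP[] : 0 <= b 3%N <= 1 by apply: b01; lia.
    - by apply: b_anti; lia.
    - by have /andP[] : 0 <= b 2%N <= 1 by apply: b01; lia.
  have k2 : k = 2%N by lia.
  have -> : b k.+2 = 0 by rewrite -bn; congr b; lia.
  rewrite k2; apply: mid32 => //.
  - by have /andP[] : 0 <= b 3%N <= 1 by apply: b01; lia.
  - by apply: b_anti; lia.
  - by have /andP[] : 0 <= b 2%N <= 1 by apply: b01; lia.
apply: mid4 => //; first by lia.
- by have /andP[] : 0 <= b k.+2 <= 1 by apply: b01; lia.
- by apply: b_anti; lia.
- by apply: b_anti; lia.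
- by have /andP[] : 0 <= b k <= 1 by apply: b01; lia.
Qed.

End Operator.

Theorem theorem4p1 (R : realType) (d : Order.disp_t) (U : orderType d)
    (lep : rel U) (add : SemiGroup.com_law U) (K : set U) (bot top : U)
    (L : U -> U -> R -> R -> U) (n : nat)
    (lep_order : partial_order lep)
    (lep_admissible : admissible_order lep)
    (bot_least : least_in lep K bot)
    (top_greatest : greatest_in lep K top)
    (bot_neq_top : bot <> top)
    (L_in_K : forall (x y : U) (a b : R), K x -> K y ->
       0 <= a <= 1 -> 0 <= b <= 1 -> K (L x y a b))
    (n_ge2 : (2 <= n)%N)
    (add_compatible : lt_compatible add) :
  aggregation_function add K bot top L n
  <->
  [/\ (* (a) *)
      well_defined add K bot L n
      /\ (forall (u : U) (b : R), K u -> 0 <= b <= 1 ->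
            nondecreasing_on (segment K u top) (fun x => L x u b 0))
      /\ [/\ n = 2%N ->
             forall (v : U) (b : R), K v -> 0 <= b <= 1 ->
               nondecreasing_on (segment K bot v)
                 (fun x => add (L x bot 1 b) (L v x b 0)),
             n = 3%N ->
             (forall (v : U) (b1 b2 : R), K v ->
                0 <= b2 -> b2 <= b1 -> b1 <= 1 ->
                nondecreasing_on (segment K bot v)
                  (fun x => add (L x bot 1 b1) (L v x b1 b2)))
             /\ (forall (u v : U) (b1 b2 : R), K u -> K v -> (u <= v)%O ->
                0 <= b2 -> b2 <= b1 -> b1 <= 1 ->
                nondecreasing_on (segment K u v)
                  (fun x => add (L x u b1 b2) (L v x b2 0)))
           & (4 <= n)%N ->
             forall (u v : U) (b1 b2 b3 : R), K u -> K v -> (u <= v)%O ->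
               0 <= b3 -> b3 <= b2 -> b2 <= b1 -> b1 <= 1 ->
               nondecreasing_on (segment K u v)
                 (fun x => add (L x u b1 b2) (L v x b2 b3))],
      (* (b) *)
      forall b : nat -> R, unit_chain n b ->
        bigadd add 1 n (fun i => L bot bot (b i) (b i.+1)) = bot
    & (* (c) *)
      forall b : nat -> R, unit_chain n b ->
        add (L top bot (b 1%N) (b 2%N))
            (bigadd add 2 n (fun i => L top top (b i) (b i.+1))) = top].
Proof.
have [Kbot bot_le] := bot_least; have [Ktop top_ge] := top_greatest.
(* Admissibility carries the bounds of [K] from [lep] over to the total order. *)
have le_bot x : K x -> (bot <= x)%O by move=> /bot_le/lep_admissible.
have le_top x : K x -> (x <= top)%O by move=> /top_ge/lep_admissible.
have n_gt0 : (0 < n)%N := ltnW n_ge2.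
have monoE := monotoneP L add_compatible Kbot Ktop le_bot le_top n_ge2.
have midE := mid_step_cases add L Kbot le_bot n_ge2.
have botE := boundary_chain_sum add bot L bot bot n_gt0.
have topE := boundary_chain_sum add bot L top top n_gt0.
split=> [[/monoE[wd lastP /midE midP] /botE cbot /topE ctop]|].
  split=> // b bc; first by rewrite -chain_sum_bot// cbot.
  by rewrite -chain_sum_cst// ctop.
move=> [[wd [lastP /midE midP]] cbot ctop]; split; first exact/monoE.
- by apply/botE => b /cbot; rewrite -chain_sum_bot.
- by apply/topE => b /ctop; rewrite -chain_sum_cst.
Qed.
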